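(* Let $M_2$ be the Turing machine with states $A,B$ (plus the halting state $H$), symbols $0,1,2,3$ ($0$ blank) and transition table $\delta(A,0)=(1,R,B)$, $\delta(A,1)=(2,L,A)$, $\delta(A,2)=(1,R,A)$, $\delta(A,3)=(1,R,A)$; $\delta(B,0)=(1,L,B)$, $\delta(B,1)=(1,L,A)$, $\delta(B,2)=(3,R,B)$, $\delta(B,3)=(1,R,H)$. For $n \ge 0$ let $C(n,1) = {}^\omega 0\,(A0)\,2^n\,1\,0^\omega$ and $C(n,2) = {}^\omega 0\,(A0)\,2^n\,1\,1\,0^\omega$. Then (a) ${}^\omega 0(A0)0^\omega \vdash(6)\ C(1,2)$, and, for all integers $k\ge 0$: (b) $C(3k,1) \vdash(15k^2+9k+3)\ C(5k+1,1)$; (c) $C(3k+1,1) \vdash(15k^2+24k+13)\ {}^\omega 0\,1\,3^{5k+2}\,1\,(H1)\,0^\omega$; (d) $C(3k+2,1) \vdash(15k^2+29k+17)\ C(5k+4,2)$; (e) $C(3k,2) \vdash(15k^2+11k+3)\ C(5k+1,2)$; (f) $C(3k+1,2) \vdash(15k^2+21k+7)\ C(5k+3,1)$; (g) $C(3k+2,2) \vdash(15k^2+36k+23)\ {}^\omega 0\,1\,3^{5k+4}\,1\,(H1)\,0^\omega$.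
   Context: Turing machines here have one tape, infinite in both directions. $\delta(q,a)=(b,D,q')$ means: in state $q$ reading symbol $a$, the machine writes $b$ on the current cell, moves the head one cell left ($D=L$) or right ($D=R$), and enters state $q'$. When the machine enters the halting state $H$ it stops. A configuration is written ${}^\omega 0\, x\,(S a)\, y\, 0^\omega$, where $x,y$ are finite words: the tape contains the word $xay$ surrounded on both sides by infinitely many $0$'s, the machine is in state $S$, and the head scans the cell containing the displayed symbol $a$. Each digit is one tape symbol; $w^n$ denotes the concatenation of $n$ copies of $w$ (an exponent applies to the single preceding symbol unless parentheses are used), $w^0$ is empty. $C_1 \vdash(t)\ C_2$ means that the machine, started in configuration $C_1$, is in configuration $C_2$ after exactly $t$ steps. *)

(* Defs.v *)
From mathcomp Require Import all_boot all_order all_algebra.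

Set Implicit Arguments.
Unset Strict Implicit.
Unset Printing Implicit Defensive.

Inductive direction := L | R.

(* [delta q a = None] means that the machine has stopped: [q] is halting. *)
Record machine := Machine {
  state : Type;
  symbol : Type;
  blank : symbol;
  delta : state -> symbol -> option (symbol * direction * state) }.

Record config (M : machine) := Config {
  cur_state : state M;
  head_pos : int;
  tape : int -> symbol M }.

Definition write (T : Type) (f : int -> T) (p : int) (b : T) : int -> T :=
  fun i => if i == p then b else f i.

Definition move_head (p : int) (d : direction) : int :=
  match d with L => (p - 1)%R | R => (p + 1)%R end.

Definition step (M : machine) (c : config M) : option (config M) :=
  match delta (cur_state c) (tape c (head_pos c)) with
  | Some (b, d, q) => Some (Config q (move_head (head_pos c) d) (write (tape c) (head_pos c) b))
  | None => None
  end.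

(* [run t c] is [None] when the machine stops before having made [t] steps. *)
Fixpoint run (M : machine) (t : nat) (c : config M) : option (config M) :=
  match t with
  | 0 => Some c
  | t'.+1 => obind (run t') (step c)
  end.

(* [Display x S a y] is the expression ^omega 0 x (S a) y 0^omega.  It does not
   say where on the tape the head is, so it is satisfied by all translates of
   a configuration. *)
Record display (M : machine) := Display {
  dleft : seq (symbol M);
  dstate : state M;
  dscan : symbol M;
  dright : seq (symbol M) }.

(* The symbol at (signed) distance [i] from the head; [Negz n] is -(n+1). *)
Definition cell (M : machine) (D : display M) (i : int) : symbol M :=
  match i with
  | Posz 0 => dscan D
  | Posz n.+1 => nth (blank M) (dright D) n
  | Negz n => nth (blank M) (rev (dleft D)) n
  end.

Definition shows (M : machine) (c : config M) (D : display M) : Prop :=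
  cur_state c = dstate D /\
  forall i : int, tape c (head_pos c + i)%R = cell D i.

Definition reaches (M : machine) (t : nat) (D1 D2 : display M) : Prop :=
  forall c1 : config M, shows c1 D1 ->
  exists2 c2 : config M, run t c1 = Some c2 & shows c2 D2.

Inductive state2 := A | B | H.

Inductive symbol4 := s0 | s1 | s2 | s3.

Definition delta2 (q : state2) (a : symbol4) :
    option (symbol4 * direction * state2) :=
  match q, a with
  | A, s0 => Some (s1, R, B)
  | A, s1 => Some (s2, L, A)
  | A, s2 => Some (s1, R, A)
  | A, s3 => Some (s1, R, A)
  | B, s0 => Some (s1, L, B)
  | B, s1 => Some (s1, L, A)
  | B, s2 => Some (s3, R, B)
  | B, s3 => Some (s1, R, H)
  | H, _ => None
  end.

Definition M2 : machine := Machine s0 delta2.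

Definition start : display M2 := @Display M2 [::] A s0 [::].

Definition C1 (n : nat) : display M2 :=
  @Display M2 [::] A s0 (nseq n s2 ++ [:: s1]).

Definition C2 (n : nat) : display M2 :=
  @Display M2 [::] A s0 (nseq n s2 ++ [:: s1; s1]).

Definition halted (n : nat) : display M2 :=
  @Display M2 (s1 :: nseq n s3 ++ [:: s1]) H s1 [::].

(* Main.v *)
Require Import Defs.
From mathcomp Require Import all_boot all_order all_algebra.
From mathcomp Require Import zify.
Import GRing.Theory.

(** From [C(n,e)] the machine first turns [0 2^n] into [1 3^n].  It then sweeps
    back and forth over a growing block [2^m 1^e] with [e <= 2], each sweep
    consuming one of the [3]s.  A sweep turns [(m, e+1)] into [(m+2, e)] and
    [(m, 0)] into [(m+1, 2)], so three sweeps add [5] to [m] and restore [e]: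
    this is where [n = 3k + r] becomes [5k + r'].  Once the [3]s are exhausted,
    the leftmost [1] is turned into a [2], giving [C(m+1, e)]; for [e = 0] this
    configuration halts. *)

Lemma run_add {M : machine} (t1 t2 : nat) (c : config M) :
  run (t1 + t2) c = obind (run t2) (run t1 c).
Proof.
by elim: t1 c => [|t1 IH] c //=; case: (step c) => //= c'.
Qed.

Lemma reaches_refl {M : machine} (D : display M) : reaches 0 D D.
Proof. by move=> c cD; exists c. Qed.

Lemma reaches_trans {M : machine} {D2 D1 D3 : display M} {t1 t2 : nat} :
  reaches t1 D1 D2 -> reaches t2 D2 D3 -> reaches (t1 + t2) D1 D3.
Proof.
move=> r12 r23 c1 /r12[c2 run1 /r23[c3 run2 c3D]].
by exists c3 => //; rewrite run_add run1.
Qed.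

(* [zipper x q y]: state [q], the cells to the left of the head are [x] read from
   the head outwards, and [y] starts with the scanned cell. *)
Definition zipper {M : machine} (x : seq (symbol M)) (q : state M)
    (y : seq (symbol M)) : display M :=
  Display (rev x) q (head (blank M) y) (behead y).

(** The rest of the run is a premise, so that repeated application executes the machine forwards. An
    empty [y] stands for blanks. *)
Lemma zipper_stepR {M : machine} (x y : seq (symbol M)) (q q' : state M)
    (b : symbol M) (D : display M) (t : nat) :
  delta q (head (blank M) y) = Some (b, R, q') ->
  reaches t (zipper (b :: x) q' (behead y)) D ->
  reaches t.+1 (zipper x q y) D.
Proof.
move=> dE; rewrite -[t.+1]add1n; apply: reaches_trans.
move=> c [/= qE cE]; have /= c0 := cE 0%R; rewrite addr0 in c0.
eexists; first by rewrite /= /step qE c0 dE.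
split=> //= i; rewrite /write -addrA cE.
(* Cells right of the written one, that cell itself (at distance -1), and cells left of it. *)
case: i => [n|[|n]].
- rewrite ifF; last by lia.
  by rewrite -PoszD add1n; case: n => [|n]; rewrite /cell /= ?nth0 // !nth_behead.
- by rewrite ifT; [rewrite /cell /= revK | lia].
- rewrite ifF; last by lia.
  have -> : (1 + Negz n.+1 = Negz n)%R by lia.
  by rewrite /cell /= !revK.
Qed.

Lemma zipper_stepL {M : machine} (x y : seq (symbol M)) (q q' : state M)
    (b : symbol M) (D : display M) (t : nat) :
  delta q (head (blank M) y) = Some (b, L, q') ->
  reaches t (zipper (behead x) q' (head (blank M) x :: b :: behead y)) D ->
  reaches t.+1 (zipper x q y) D.
Proof.
move=> dE; rewrite -[t.+1]add1n; apply: reaches_trans.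
move=> c [/= qE cE]; have /= c0 := cE 0%R; rewrite addr0 in c0.
eexists; first by rewrite /= /step qE c0 dE.
split=> //= i; rewrite /write -addrA cE.
case: i => [[|[|n]]|n].
- rewrite ifF; last by lia.
  by rewrite /cell /= revK nth0.
- by rewrite ifT //; lia.
- rewrite ifF; last by lia.
  by have -> : (-1 + Posz n.+2 = Posz n.+1)%R by lia.
- rewrite ifF; last by lia.
  have -> : (-1 + Negz n = Negz n.+1)%R by lia.
  by rewrite /cell /= !revK nth_behead.
Qed.

Ltac tm_step :=
  first [ apply: zipper_stepR; [reflexivity|]
        | apply: zipper_stepL; [reflexivity|] ].

Lemma nseq_cons_comm (T : Type) (n : nat) (a : T) (s : seq T) :
  nseq n a ++ a :: s = a :: nseq n a ++ s.
Proof. by elim: n => //= n ->. Qed.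

Lemma sweepA_right (n : nat) (x y : seq symbol4) :
  reaches n (@zipper M2 x A (nseq n s2 ++ y)) (@zipper M2 (nseq n s1 ++ x) A y).
Proof.
elim: n x => [|n IH] x; first exact: reaches_refl.
by tm_step; move: (IH (s1 :: x)); rewrite nseq_cons_comm.
Qed.

Lemma sweepB_right (n : nat) (x y : seq symbol4) :
  reaches n (@zipper M2 x B (nseq n s2 ++ y)) (@zipper M2 (nseq n s3 ++ x) B y).
Proof.
elim: n x => [|n IH] x; first exact: reaches_refl.
by tm_step; move: (IH (s3 :: x)); rewrite nseq_cons_comm.
Qed.

(** Of the [n.+1] ones the leftmost stays scanned: the step on it would already move into the
    arbitrary word [x]. *)
Lemma sweepA_left (n : nat) (x y : seq symbol4) :
  reaches n (@zipper M2 (nseq n s1 ++ x) A (s1 :: y))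
    (@zipper M2 x A (s1 :: nseq n s2 ++ y)).
Proof.
elim: n y => [|n IH] y; first exact: reaches_refl.
by tm_step; move: (IH (s2 :: y)); rewrite nseq_cons_comm.
Qed.

(** Convertible to [C1 n] for [e = 1] and to [C2 n] for [e = 2]; the value [e = 0] is met only
    before halting. *)
Definition C (n e : nat) : display M2 :=
  @zipper M2 [::] A (s0 :: nseq n s2 ++ nseq e s1).

(* [1 3^l 2^m 1^e] with the head, in state [A], on the last symbol of [1 3^l]. *)
Definition sweeping (l m e : nat) : display M2 :=
  let x := nseq l s3 ++ [:: s1] in
  @zipper M2 (behead x) A (head s0 x :: nseq m s2 ++ nseq e s1).

Lemma C_sweeping (n e : nat) : reaches (n + 2) (C n e.+1) (sweeping n 0 e.+1).
Proof.
have -> : n + 2 = n.+1 + 1 by lia.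
apply: reaches_trans.
  by tm_step; apply: sweepB_right.
by tm_step; apply: reaches_refl.
Qed.

Lemma sweep0 (l m : nat) :
  reaches (2 * m + 5) (sweeping l.+1 m 0) (sweeping l m.+1 2).
Proof.
have -> : 2 * m + 5 = (m + (m + 1).+3).+1 by lia.
tm_step; apply: reaches_trans; first exact: sweepA_right.
(* Past the block, [A] and then [B] write a 1 on a blank. These two ones are the new tail, and [B]
   turns back over the first of them, becoming [A]. *)
rewrite nseq_cons_comm; do 3 tm_step.
apply: reaches_trans (sweepA_left m _ _) _.
by tm_step; apply: reaches_refl.
Qed.

Lemma sweepS (l m e : nat) :
  reaches (2 * m + 3) (sweeping l.+1 m e.+1) (sweeping l m.+2 e).
Proof.
have -> : 2 * m + 3 = (m + (m.+1 + 1)).+1 by lia.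
tm_step; apply: reaches_trans; first exact: sweepA_right.
rewrite nseq_cons_comm.
(* The first 1 of the tail turns [A] back and is itself converted, hence [m.+1]. *)
apply: reaches_trans (sweepA_left m.+1 _ _) _.
by tm_step; apply: reaches_refl.
Qed.

(** The tail length cycles through 0, 2, 1, so [sweep0] occurs once, as sweep number [e.+1]. The
    three block lengths add up to [3 * m + 4 + e], which explains the term [2 * e]. *)
Lemma sweep3 (l m e : nat) : e <= 2 ->
  reaches (6 * m + 19 + 2 * e) (sweeping l.+3 m e) (sweeping l (m + 5) e).
Proof.
rewrite [m + 5]addnC; case: e => [|[|[|//]]] _.
- have -> : 6 * m + 19 + 2 * 0 = (2 * m + 5) + ((2 * m.+1 + 3) + (2 * m.+3 + 3)) by lia.
  apply: reaches_trans; first exact: sweep0.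
  by apply: reaches_trans; apply: sweepS.
- have -> : 6 * m + 19 + 2 * 1 = (2 * m + 3) + ((2 * m.+2 + 5) + (2 * m.+3 + 3)) by lia.
  apply: reaches_trans; first exact: sweepS.
  by apply: reaches_trans; [apply: sweep0 | apply: sweepS].
- have -> : 6 * m + 19 + 2 * 2 = (2 * m + 3) + ((2 * m.+2 + 3) + (2 * m.+4 + 5)) by lia.
  apply: reaches_trans; first exact: sweepS.
  by apply: reaches_trans; [apply: sweepS | apply: sweep0].
Qed.

(** The time is the sum of the arithmetic progression [6 * (m + 5 * i) + 19 + 2 * e] over
    [i < k]. *)
Lemma sweep3k (k l m e : nat) : e <= 2 ->
  reaches (15 * k ^ 2 + (6 * m + 4 + 2 * e) * k)
    (sweeping (3 * k + l) m e) (sweeping l (m + 5 * k) e).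
Proof.
move=> e2; elim: k m => [|k IH] m.
  by rewrite !muln0 !addn0; apply: reaches_refl.
have -> : 15 * k.+1 ^ 2 + (6 * m + 4 + 2 * e) * k.+1 =
    (6 * m + 19 + 2 * e) + (15 * k ^ 2 + (6 * (m + 5) + 4 + 2 * e) * k) by nia.
have -> : 3 * k.+1 + l = (3 * k + l).+3 by lia.
have -> : m + 5 * k.+1 = m + 5 + 5 * k by lia.
by apply: reaches_trans; first exact: sweep3.
Qed.

Lemma sweeping_C (m e : nat) : reaches 1 (sweeping 0 m e) (C m.+1 e).
Proof. by tm_step; apply: reaches_refl. Qed.

(** Without a tail, [B] meets a blank after the threes, writes 1, and steps back onto the last 3,
    which halts it and becomes a 1. *)
Lemma C_halted (n : nat) : reaches (n + 4) (C n.+1 0) (halted n).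
Proof.
have -> : n + 4 = (n.+1 + 2).+1 by lia.
tm_step; apply: reaches_trans; first exact: sweepB_right.
do 2 tm_step.
(* The left word is a palindrome, so the reversal in [zipper] is harmless. *)
have -> : halted n = @zipper M2 (s1 :: nseq n s3 ++ [:: s1]) H [:: s1].
  by rewrite /halted /zipper rev_cons rev_cat rev_nseq -cats1.
exact: reaches_refl.
Qed.

(** This phase is common to (b)-(g), which differ only in how the last [r] threes are consumed. *)
Lemma C_sweeping3k (k r e : nat) : e <= 1 ->
  reaches (15 * k ^ 2 + (9 + 2 * e) * k + r + 2)
    (C (3 * k + r) e.+1) (sweeping r (5 * k) e.+1).
Proof.
move=> e1.
have -> : 15 * k ^ 2 + (9 + 2 * e) * k + r + 2 =
  (3 * k + r + 2) + (15 * k ^ 2 + (6 * 0 + 4 + 2 * e.+1) * k) by lia.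
apply: reaches_trans; first exact: C_sweeping.
exact: sweep3k.
Qed.

Theorem theorem4p1 :
  reaches 6 start (C2 1) /\
  forall k : nat,
    reaches (15 * k ^ 2 + 9 * k + 3) (C1 (3 * k)) (C1 (5 * k + 1)) /\
    reaches (15 * k ^ 2 + 24 * k + 13) (C1 (3 * k + 1)) (halted (5 * k + 2)) /\
    reaches (15 * k ^ 2 + 29 * k + 17) (C1 (3 * k + 2)) (C2 (5 * k + 4)) /\
    reaches (15 * k ^ 2 + 11 * k + 3) (C2 (3 * k)) (C2 (5 * k + 1)) /\
    reaches (15 * k ^ 2 + 21 * k + 7) (C2 (3 * k + 1)) (C1 (5 * k + 3)) /\
    reaches (15 * k ^ 2 + 36 * k + 23) (C2 (3 * k + 2)) (halted (5 * k + 4)).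
Proof.
split.
  rewrite -[start]/(@zipper M2 [::] A [::]).
  by do 6 tm_step; apply: reaches_refl.
move=> k.
have from1 r := C_sweeping3k k r 0 isT.
have from2 r := C_sweeping3k k r 1 isT.
split; [|split; [|split; [|split; [|split]]]].
- have -> : 15 * k ^ 2 + 9 * k + 3 =
    (15 * k ^ 2 + (9 + 2 * 0) * k + 0 + 2) + 1 by lia.
  move: (from1 0); rewrite [3 * k + 0]addn0 [5 * k + 1]addn1 => from.
  exact: reaches_trans from (sweeping_C _ _).
(* One more sweep empties the tail, so the next pass halts. *)
- have -> : 15 * k ^ 2 + 24 * k + 13 =
    (15 * k ^ 2 + (9 + 2 * 0) * k + 1 + 2) +
    ((2 * (5 * k) + 3) + (1 + ((5 * k).+2 + 4))) by lia.
  rewrite [5 * k + 2]addn2.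
  apply: reaches_trans (from1 1) _; apply: reaches_trans (sweepS _ _ _) _.
  exact: reaches_trans (sweeping_C _ _) (C_halted _).
(* The second remaining sweep refills the emptied tail to length 2. *)
- have -> : 15 * k ^ 2 + 29 * k + 17 =
    (15 * k ^ 2 + (9 + 2 * 0) * k + 2 + 2) +
    ((2 * (5 * k) + 3) + ((2 * (5 * k).+2 + 5) + 1)) by lia.
  rewrite [5 * k + 4]addn4.
  apply: reaches_trans (from1 2) _; apply: reaches_trans (sweepS _ _ _) _.
  exact: reaches_trans (sweep0 _ _) (sweeping_C _ _).
- have -> : 15 * k ^ 2 + 11 * k + 3 =
    (15 * k ^ 2 + (9 + 2 * 1) * k + 0 + 2) + 1 by lia.
  move: (from2 0); rewrite [3 * k + 0]addn0 [5 * k + 1]addn1 => from.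
  exact: reaches_trans from (sweeping_C _ _).
- have -> : 15 * k ^ 2 + 21 * k + 7 =
    (15 * k ^ 2 + (9 + 2 * 1) * k + 1 + 2) + ((2 * (5 * k) + 3) + 1) by lia.
  rewrite [5 * k + 3]addn3.
  apply: reaches_trans (from2 1) _.
  exact: reaches_trans (sweepS _ _ _) (sweeping_C _ _).
(* Two sweeps use up both ones of the tail. *)
- have -> : 15 * k ^ 2 + 36 * k + 23 =
    (15 * k ^ 2 + (9 + 2 * 1) * k + 2 + 2) + ((2 * (5 * k) + 3) +
    ((2 * (5 * k).+2 + 3) + (1 + ((5 * k).+4 + 4)))) by lia.
  rewrite [5 * k + 4]addn4.
  apply: reaches_trans (from2 2) _; apply: reaches_trans (sweepS _ _ _) _.
  apply: reaches_trans (sweepS _ _ _) _.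
  exact: reaches_trans (sweeping_C _ _) (C_halted _).
Qed.
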